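(* Let $m_1,m_2,m_3,m_4$ be positive integers, $m=m_2m_3+m_1m_4+m_1m_2$, and let $A,B,C\in\mathbb{C}$ be nonzero with $B/A\notin\mathbb{R}$, $BC(B-C)=m_2m_3$, $CA(C-A)=m_1m_4$, $AB(A-B)=m_1m_2$. Let $f(x,y)=(m_2Ax+m_1By)^2/A$. Let $L$ be a positive integer and $\Lambda\subseteq\{0,1,\dots,L-1\}$ a set containing no solutions to $m_2m_3x+m_1m_4y+m_1m_2z=mw$ other than those with $x=y=z=w$, and let $\psi\in\mathbb{C}$. For $j=(j_1,j_2)\in\Lambda^2$ let \[I_j=A\Big[\tfrac{j_1}{mL},\tfrac{j_1}{mL}+\tfrac{1}{m^2L}\Big)+B\Big[\tfrac{j_2}{mL},\tfrac{j_2}{mL}+\tfrac{1}{m^2L}\Big)\subseteq\mathbb{C}/(A\mathbb{Z}+B\mathbb{Z}),\qquad \mathcal{B}=\bigcup_{j\in\Lambda^2}I_j.\] Let $n_1,n_2,d\in\mathbb{Z}$ and $w=\psi f(n_1,n_2)$, $x=\psi f(n_1+m_1d,n_2)$, $y=\psi f(n_1,n_2+m_2d)$, $z=\psi f(n_1-m_3d,n_2-m_4d)$. If $w,x,y,z\pmod{A\mathbb{Z}+B\mathbb{Z}}$ all lie in $\mathcal{B}$, then \[\big\|2m_1m_2(m_2An_1+m_1Bn_2)d\psi+m_1^2m_2^2Ad^2\psi\big\|_{A,B}<\frac{1}{m^2L}.\]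
   Context: Since $B/A\notin\mathbb{R}$, every $u\in\mathbb{C}$ can be written uniquely as $u=u_1A+u_2B$ with $u_1,u_2\in\mathbb{R}$; define $\|u\|_{A,B}=\max\{\|u_1\|_{\mathbb{R}/\mathbb{Z}},\|u_2\|_{\mathbb{R}/\mathbb{Z}}\}$, where $\|t\|_{\mathbb{R}/\mathbb{Z}}$ is the distance from $t\in\mathbb{R}$ to the nearest integer. *)

(* Defs.v *)
From Stdlib Require Import Reals ZArith Lra Lia ClassicalEpsilon.
From Coquelicot Require Import Coquelicot.

Definition ZtoC (n : Z) : C := RtoC (IZR n).

(** [||t||_{R/Z}]. *)
Definition dist_int (t : R) : R :=
  real (Glb_Rbar (fun r => exists n : Z, r = Rabs (t - IZR n)%R)).

(** The pair [(u1, u2)] with [u = u1 A + u2 B]; meaningful only when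
    [B / A] is not real, see [coords_exists_unique]. *)
Definition coords (A B u : C) : R * R :=
  epsilon (inhabits (0%R, 0%R))
    (fun p : R * R => u = (RtoC (fst p) * A + RtoC (snd p) * B)%C).

(** [||u||_{A,B}]. *)
Definition norm_AB (A B u : C) : R :=
  Rmax (dist_int (fst (coords A B u))) (dist_int (snd (coords A B u))).

Definition is_real (z : C) : Prop := exists r : R, z = RtoC r.

Definition cong_lattice (A B u v : C) : Prop :=
  exists k l : Z, (u - v)%C = (ZtoC k * A + ZtoC l * B)%C.

Definition quad_f (m1 m2 : Z) (A B : C) (x y : Z) : C :=
  ((ZtoC m2 * A * ZtoC x + ZtoC m1 * B * ZtoC y) ^ 2 / A)%C.

Definition in_interval (m L j : Z) (t : R) : Prop :=
  (IZR j / (IZR m * IZR L) <= t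
     < IZR j / (IZR m * IZR L) + 1 / (IZR m ^ 2 * IZR L))%R.

(** Subsets of [C / (A Z + B Z)] are represented by their preimages in [C]:
    [box_I A B m L j1 j2 u] says that [u mod (A Z + B Z)] lies in [I_(j1,j2)]. *)
Definition box_I (A B : C) (m L j1 j2 : Z) (u : C) : Prop :=
  exists s t : R, in_interval m L j1 s /\ in_interval m L j2 t /\
    cong_lattice A B u (RtoC s * A + RtoC t * B)%C.

Definition union_B (A B : C) (m L : Z) (Lambda : Z -> Prop) (u : C) : Prop :=
  exists j1 j2 : Z, Lambda j1 /\ Lambda j2 /\ box_I A B m L j1 j2 u.

Definition only_trivial_solutions (m1 m2 m3 m4 m : Z) (Lambda : Z -> Prop)
  : Prop :=
  forall x y z w : Z, Lambda x -> Lambda y -> Lambda z -> Lambda w ->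
    (m2 * m3 * x + m1 * m4 * y + m1 * m2 * z = m * w)%Z ->
    x = y /\ y = z /\ z = w.

Lemma dist_int_nearest (t : R) :
  (exists n : Z, dist_int t = Rabs (t - IZR n)) /\
  (forall n : Z, (dist_int t <= Rabs (t - IZR n))%R).
Proof.
  set (P := fun r => exists n : Z, r = Rabs (t - IZR n)%R).
  assert (Hex : exists n : Z,
            forall k : Z, (Rabs (t - IZR n) <= Rabs (t - IZR k))%R).
  { destruct (archimed (t - 1/2)) as [H1 H2].
    exists (up (t - 1/2)). intros k.
    set (n := up (t - 1/2)) in *.
    destruct (Z.lt_trichotomy k n) as [H | [-> | H]].
    - assert (IZR k <= IZR n - 1)%R
        by (rewrite <- minus_IZR; apply IZR_le; lia).
      unfold Rabs; destruct (Rcase_abs _), (Rcase_abs _); lra.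
    - lra.
    - assert (IZR n + 1 <= IZR k)%R
        by (rewrite <- plus_IZR; apply IZR_le; lia).
      unfold Rabs; destruct (Rcase_abs _), (Rcase_abs _); lra. }
  destruct Hex as [n Hn].
  assert (Hglb : Glb_Rbar P = Finite (Rabs (t - IZR n))).
  { apply is_glb_Rbar_unique. split.
    - intros x [k ->]. simpl. apply Hn.
    - intros b Hb. apply Hb. exists n. reflexivity. }
  assert (Hd : dist_int t = Rabs (t - IZR n)).
  { unfold dist_int. change (real (Glb_Rbar P) = Rabs (t - IZR n)).
    rewrite Hglb. reflexivity. }
  rewrite Hd. split; [exists n; reflexivity | exact Hn].
Qed.

Lemma coords_exists_unique (A B u : C) :
  A <> RtoC 0 -> ~ is_real (B / A)%C ->
  u = (RtoC (fst (coords A B u)) * A + RtoC (snd (coords A B u)) * B)%C /\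
  forall u1 u2 : R, u = (RtoC u1 * A + RtoC u2 * B)%C ->
    coords A B u = (u1, u2).
Proof.
  intros HA HAB.
  assert (Hdet : (fst A * snd B - snd A * fst B <> 0)%R).
  { intros H0. apply HAB.
    assert (Hn : (fst A * fst A + snd A * snd A <> 0)%R).
    { intros Hz. apply HA. destruct A as [a1 a2]; simpl in *.
      assert (a1 = 0)%R by nra. assert (a2 = 0)%R by nra. subst. reflexivity. }
    exists ((fst B * fst A + snd B * snd A)
            / (fst A * fst A + snd A * snd A))%R.
    destruct A as [a1 a2], B as [b1 b2]; simpl in *.
    unfold Cdiv, Cmult, Cinv, RtoC; simpl. f_equal; field_simplify_eq; try lra;
    try (intros Hz; apply Hn; lra). }
  assert (Hspec : u = (RtoC (fst (coords A B u)) * A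
                       + RtoC (snd (coords A B u)) * B)%C).
  { unfold coords. apply (epsilon_spec (inhabits (0%R, 0%R))
      (fun p : R * R => u = (RtoC (fst p) * A + RtoC (snd p) * B)%C)).
    exists (((fst u * snd B - snd u * fst B)
             / (fst A * snd B - snd A * fst B))%R,
            ((fst A * snd u - snd A * fst u)
             / (fst A * snd B - snd A * fst B))%R).
    destruct A as [a1 a2], B as [b1 b2], u as [v1 v2]; simpl in *.
    unfold Cplus, Cmult, RtoC; simpl. f_equal; field; exact Hdet. }
  split; [exact Hspec |].
  intros u1 u2 Hu. destruct (coords A B u) as [p q]; simpl in *.
  rewrite Hu in Hspec.
  destruct A as [a1 a2], B as [b1 b2]; simpl in *.
  unfold Cplus, Cmult, RtoC in Hspec; simpl in Hspec.
  injection Hspec as E1 E2.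
  f_equal; apply (Rmult_eq_reg_r (a1 * b2 - a2 * b1)%R); trivial.
  - assert (F1 := f_equal (fun t => t * b2)%R E1).
    assert (F2 := f_equal (fun t => t * b1)%R E2). simpl in F1, F2. lra.
  - assert (F1 := f_equal (fun t => t * a2)%R E1).
    assert (F2 := f_equal (fun t => t * a1)%R E2). simpl in F1, F2. lra.
Qed.

(* Main.v *)
(** Write [a = m2 m3], [b = m1 m4], [c = m1 m2].  The
    relations between [A], [B], [C] force [a x + b y + c z = m w].  Comparing
    the coordinates along [A] and [B] modulo [1], the rounding errors total less
    than [1 / (m L)], so the digits [j] satisfy [a jx + b jy + c jz - m jw = N m L]
    with [N] an integer; since the digits lie in [[0, L - 1]], [N = 0], and the
    hypothesis on [Lambda] gives [jx = jw].  Hence [x - w], which is the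
    number in the conclusion, has both coordinates within [1 / (m^2 L)] of integers. *)

Require Import Defs.
From Stdlib Require Import Reals ZArith Lra Lia.
From Coquelicot Require Import Coquelicot.

Lemma ZtoC_plus (p q : Z) : ZtoC (p + q) = (ZtoC p + ZtoC q)%C.
Proof. unfold ZtoC. now rewrite plus_IZR, RtoC_plus. Qed.

Lemma ZtoC_minus (p q : Z) : ZtoC (p - q) = (ZtoC p - ZtoC q)%C.
Proof. unfold ZtoC. now rewrite minus_IZR, RtoC_minus. Qed.

Lemma ZtoC_mult (p q : Z) : ZtoC (p * q) = (ZtoC p * ZtoC q)%C.
Proof. unfold ZtoC. now rewrite mult_IZR, RtoC_mult. Qed.

Lemma lattice_coords_eq (A B : C) (p q r s : R) :
  A <> RtoC 0 -> ~ is_real (B / A)%C ->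
  (RtoC p * A + RtoC q * B)%C = (RtoC r * A + RtoC s * B)%C -> p = r /\ q = s.
Proof.
  intros HA HBA E.
  destruct (coords_exists_unique A B (RtoC p * A + RtoC q * B)%C HA HBA)
    as [_ Hu].
  pose proof (Hu p q eq_refl) as H1. pose proof (Hu r s E) as H2.
  rewrite H1 in H2. now injection H2.
Qed.

Lemma dist_int_lt (t e : R) (n : Z) :
  (Rabs (t - IZR n) < e)%R -> (dist_int t < e)%R.
Proof.
  intros H. eapply Rle_lt_trans; [apply dist_int_nearest | exact H].
Qed.

(** Multiplying by [m ^ 2 * L] clears both denominators: the interval becomes [[m j, m j + 1)], and
    [e] is the rounding error in these units. *)
Lemma in_interval_scaled (m L j : Z) (t : R) :
  (0 < m)%Z -> (0 < L)%Z -> in_interval m L j t ->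
  exists e : R, (0 <= e < 1)%R /\
    (IZR m * IZR m * IZR L * t = IZR m * IZR j + e)%R.
Proof.
  intros Hm HL [H1 H2].
  apply IZR_lt in Hm, HL.
  set (M := (IZR m * IZR m * IZR L)%R).
  assert (HM : (0 < M)%R) by (unfold M; repeat apply Rmult_lt_0_compat; lra).
  assert (E1 : (M * (IZR j / (IZR m * IZR L)) = IZR m * IZR j)%R)
    by (unfold M; field; lra).
  assert (E2 : (M * (1 / (IZR m ^ 2 * IZR L)) = 1)%R)
    by (unfold M; field; lra).
  apply (Rmult_le_compat_l M) in H1; [| lra].
  apply (Rmult_lt_compat_l M) in H2; [| exact HM].
  exists (M * t - IZR m * IZR j)%R. lra.
Qed.

Lemma in_interval_same_digit (m L j : Z) (s t : R) :
  in_interval m L j s -> in_interval m L j t ->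
  (Rabs (s - t) < 1 / (IZR m ^ 2 * IZR L))%R.
Proof. intros [H1 H2] [H3 H4]. apply Rabs_def1; lra. Qed.

(** After scaling, the digits contribute [m * J] and the right side [m * (N * m * L)], so their
    discrepancy is [m] times an integer. It is also a combination of rounding errors, and because
    the weights satisfy [a + b + c = m] it lies strictly between [-m] and [m]. Hence that integer is
    zero. *)
Lemma digits_of_integral_relation (a b c m L N jx jy jz jw : Z)
  (sx sy sz sw : R) :
  (0 < a)%Z -> (0 < b)%Z -> (0 < c)%Z -> m = (a + b + c)%Z -> (0 < L)%Z ->
  (0 <= jx <= L - 1)%Z -> (0 <= jy <= L - 1)%Z -> (0 <= jz <= L - 1)%Z ->
  (0 <= jw <= L - 1)%Z ->
  in_interval m L jx sx -> in_interval m L jy sy -> in_interval m L jz sz ->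
  in_interval m L jw sw ->
  (IZR a * sx + IZR b * sy + IZR c * sz - IZR m * sw = IZR N)%R ->
  (a * jx + b * jy + c * jz = m * jw)%Z.
Proof.
  intros Ha Hb Hc Hm HL Bx By Bz Bw Ix Iy Iz Iw E.
  assert (Hm0 : (0 < m)%Z) by lia.
  destruct (in_interval_scaled m L jx sx Hm0 HL Ix) as [ex [Lx Ex]].
  destruct (in_interval_scaled m L jy sy Hm0 HL Iy) as [ey [Ly Ey]].
  destruct (in_interval_scaled m L jz sz Hm0 HL Iz) as [ez [Lz Ez]].
  destruct (in_interval_scaled m L jw sw Hm0 HL Iw) as [ew [Lw Ew]].
  set (J := (a * jx + b * jy + c * jz - m * jw)%Z).
  assert (HmR : IZR m = (IZR a + IZR b + IZR c)%R)
    by (rewrite Hm, !plus_IZR; ring).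
  pose proof (IZR_lt _ _ Ha) as Ha'. pose proof (IZR_lt _ _ Hb) as Hb'.
  pose proof (IZR_lt _ _ Hc) as Hc'. pose proof (IZR_lt _ _ Hm0) as Hm'.
  assert (Eq : (IZR m * IZR (N * m * L - J)
                = IZR a * ex + IZR b * ey + IZR c * ez - IZR m * ew)%R).
  { unfold J. rewrite !minus_IZR, !plus_IZR, !mult_IZR.
    replace (IZR m * (IZR N * IZR m * IZR L
        - (IZR a * IZR jx + IZR b * IZR jy + IZR c * IZR jz - IZR m * IZR jw)))%R
      with (IZR m * IZR m * IZR L * IZR N
        - (IZR a * (IZR m * IZR jx) + IZR b * (IZR m * IZR jy)
           + IZR c * (IZR m * IZR jz) - IZR m * (IZR m * IZR jw)))%R by ring.
    rewrite <- E.
    replace (IZR m * IZR jx)%R with (IZR m * IZR m * IZR L * sx - ex)%R by lra.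
    replace (IZR m * IZR jy)%R with (IZR m * IZR m * IZR L * sy - ey)%R by lra.
    replace (IZR m * IZR jz)%R with (IZR m * IZR m * IZR L * sz - ez)%R by lra.
    replace (IZR m * IZR jw)%R with (IZR m * IZR m * IZR L * sw - ew)%R by lra.
    ring. }
  assert (Hlt : (IZR (N * m * L - J) < 1)%R).
  { apply (Rmult_lt_reg_l (IZR m)); [exact Hm' |]. rewrite Eq. nra. }
  assert (Hgt : (-1 < IZR (N * m * L - J))%R).
  { apply (Rmult_lt_reg_l (IZR m)); [exact Hm' |]. rewrite Eq. nra. }
  apply lt_IZR in Hlt, Hgt.
  assert (HJ : J = (N * (m * L))%Z) by lia.
  (* Both [a jx + b jy + c jz] and [m jw] lie in [[0, m (L - 1)]]. Thus [J] is a multiple of [m L]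
     of absolute value below [m L], which leaves only [N = 0]. *)
  assert (HJb : (- (m * (L - 1)) <= J <= m * (L - 1))%Z) by (unfold J; nia).
  assert (HN : N = 0%Z) by nia.
  subst N. unfold J in HJ. lia.
Qed.

(** Naming the lattice vector turns membership modulo the lattice into an exact equation in [C],
    whose real coordinates can then be compared. *)
Lemma box_I_coords (A B : C) (m L j1 j2 : Z) (u : C) :
  box_I A B m L j1 j2 u ->
  exists (s t : R) (k l : Z), in_interval m L j1 s /\ in_interval m L j2 t /\
    u = (RtoC (s + IZR k) * A + RtoC (t + IZR l) * B)%C.
Proof.
  intros (s & t & Hs & Ht & k & l & E).
  exists s, t, k, l. repeat (split; [assumption |]).
  rewrite !RtoC_plus. fold (ZtoC k) (ZtoC l).
  transitivity ((u - (RtoC s * A + RtoC t * B))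
                + (RtoC s * A + RtoC t * B))%C; [ring |].
  rewrite E. ring.
Qed.

(** The terms linear in [D] cancel for any [a], [b], [c]. The coefficient of [D ^ 2] is
    [c (c (a A^2 + b B^2) + (a A + b B)^2)]; it vanishes because the hypotheses give
    [a A + b B = A B C (B - A)] and [a A^2 + b B^2 = A B C^2 (B - A)]. *)
Lemma square_relation (A B C a b c S D : Complex.C) :
  (B * C * (B - C))%C = a -> (C * A * (C - A))%C = b ->
  (A * B * (A - B))%C = c ->
  (a * (S + c * A * D) ^ 2 + b * (S + c * B * D) ^ 2
     + c * (S - (a * A + b * B) * D) ^ 2)%C = ((a + b + c) * S ^ 2)%C.
Proof. intros <- <- <-. ring. Qed.

(** With [S = m2 A n1 + m1 B n2], the three shifts of [(n1, n2)] change [S] by [c A d], [c B d] and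
    [-(a A + b B) d], where [a = m2 m3], [b = m1 m4], [c = m1 m2]. This is the pattern of
    [square_relation]. *)
Lemma quad_f_relation (m1 m2 m3 m4 : Z) (A B C : Complex.C) (n1 n2 d : Z) :
  (B * C * (B - C))%C = ZtoC (m2 * m3) ->
  (C * A * (C - A))%C = ZtoC (m1 * m4) ->
  (A * B * (A - B))%C = ZtoC (m1 * m2) ->
  (ZtoC (m2 * m3) * quad_f m1 m2 A B (n1 + m1 * d) n2
   + ZtoC (m1 * m4) * quad_f m1 m2 A B n1 (n2 + m2 * d)
   + ZtoC (m1 * m2) * quad_f m1 m2 A B (n1 - m3 * d) (n2 - m4 * d))%C
  = (ZtoC (m2 * m3 + m1 * m4 + m1 * m2) * quad_f m1 m2 A B n1 n2)%C.
Proof.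
  intros Ha Hb Hc.
  pose proof (square_relation A B C _ _ _
    (ZtoC m2 * A * ZtoC n1 + ZtoC m1 * B * ZtoC n2)%C (ZtoC d) Ha Hb Hc) as E.
  clear Ha Hb Hc.
  unfold quad_f. rewrite !ZtoC_minus, !ZtoC_plus, !ZtoC_mult in *.
  unfold Cdiv. rewrite !Cmult_assoc, <- E. ring.
Qed.

Lemma quad_f_shift (m1 m2 : Z) (A B : C) (n1 n2 d : Z) :
  A <> RtoC 0 ->
  (quad_f m1 m2 A B (n1 + m1 * d) n2 - quad_f m1 m2 A B n1 n2)%C
  = (ZtoC 2 * ZtoC m1 * ZtoC m2
       * (ZtoC m2 * A * ZtoC n1 + ZtoC m1 * B * ZtoC n2) * ZtoC d
     + ZtoC m1 ^ 2 * ZtoC m2 ^ 2 * A * ZtoC d ^ 2)%C.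
Proof.
  intros HA. unfold quad_f. rewrite ZtoC_plus, ZtoC_mult.
  (* [IZR 2] unfolds to [1 + 1], so the coefficient 2 becomes a sum of units for [field]. *)
  change (ZtoC 2) with (RtoC (1 + 1)). rewrite RtoC_plus.
  field. exact HA.
Qed.

Theorem lemma4p5
  (m1 m2 m3 m4 m : Z)
  (hm1 : (0 < m1)%Z) (hm2 : (0 < m2)%Z) (hm3 : (0 < m3)%Z) (hm4 : (0 < m4)%Z)
  (hm : m = (m2 * m3 + m1 * m4 + m1 * m2)%Z)
  (A B C : Complex.C)
  (hA : A <> RtoC 0) (hB : B <> RtoC 0) (hC : C <> RtoC 0)
  (hBA : ~ is_real (B / A)%C)
  (hBC : (B * C * (B - C))%C = ZtoC (m2 * m3))
  (hCA : (C * A * (C - A))%C = ZtoC (m1 * m4))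
  (hAB : (A * B * (A - B))%C = ZtoC (m1 * m2))
  (L : Z) (hL : (0 < L)%Z)
  (Lambda : Z -> Prop)
  (hLambda : forall j : Z, Lambda j -> (0 <= j <= L - 1)%Z)
  (hsol : only_trivial_solutions m1 m2 m3 m4 m Lambda)
  (psi : Complex.C)
  (n1 n2 d : Z)
  (w x y z : Complex.C)
  (hw : w = (psi * quad_f m1 m2 A B n1 n2)%C)
  (hx : x = (psi * quad_f m1 m2 A B (n1 + m1 * d) n2)%C)
  (hy : y = (psi * quad_f m1 m2 A B n1 (n2 + m2 * d))%C)
  (hz : z = (psi * quad_f m1 m2 A B (n1 - m3 * d) (n2 - m4 * d))%C)
  (hwB : union_B A B m L Lambda w)
  (hxB : union_B A B m L Lambda x)
  (hyB : union_B A B m L Lambda y)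
  (hzB : union_B A B m L Lambda z) :
  (norm_AB A B
     (ZtoC 2 * ZtoC m1 * ZtoC m2
        * (ZtoC m2 * A * ZtoC n1 + ZtoC m1 * B * ZtoC n2) * ZtoC d * psi
      + ZtoC m1 ^ 2 * ZtoC m2 ^ 2 * A * ZtoC d ^ 2 * psi)%C
   < 1 / (IZR m ^ 2 * IZR L))%R.
Proof.
  assert (Ha : (0 < m2 * m3)%Z) by lia.
  assert (Hb : (0 < m1 * m4)%Z) by lia.
  assert (Hc : (0 < m1 * m2)%Z) by lia.
  assert (Hrel : (ZtoC (m2 * m3) * x + ZtoC (m1 * m4) * y
                  + ZtoC (m1 * m2) * z)%C = (ZtoC m * w)%C).
  { pose proof (quad_f_relation m1 m2 m3 m4 A B C n1 n2 d hBC hCA hAB) as E.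
    rewrite <- hm in E. apply (f_equal (Cmult psi)) in E.
    rewrite hx, hy, hz, hw.
    transitivity (psi * (ZtoC m * quad_f m1 m2 A B n1 n2))%C; [| ring].
    rewrite <- E. ring. }
  match goal with |- (norm_AB A B ?v < _)%R =>
    assert (Hdiff : v = (x - w)%C) end.
  { pose proof (quad_f_shift m1 m2 A B n1 n2 d hA) as E.
    apply (f_equal (Cmult psi)) in E.
    rewrite hx, hw.
    transitivity (psi * (quad_f m1 m2 A B (n1 + m1 * d) n2
                         - quad_f m1 m2 A B n1 n2))%C; [| ring].
    rewrite E. ring. }
  rewrite Hdiff. clear Hdiff hw hx hy hz hBC hCA hAB.
  destruct hwB as (jw & iw & Jw & Iw & Bw), hxB as (jx & ix & Jx & Ix & Bx),
    hyB as (jy & iy & Jy & Iy & By), hzB as (jz & iz & Jz & Iz & Bz).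
  apply box_I_coords in Bw, Bx, By, Bz.
  destruct Bw as (sw & tw & kw & lw & Sw & Tw & Ew),
    Bx as (sx & tx & kx & lx & Sx & Tx & Ex),
    By as (sy & ty & ky & ly & Sy & Ty & Ey),
    Bz as (sz & tz & kz & lz & Sz & Tz & Ez).
  (* Since [A] and [B] are independent over the reals, the complex relation [Hrel] splits into one
     real equation along each. *)
  assert (Hcoord :
    (IZR (m2 * m3) * (sx + IZR kx) + IZR (m1 * m4) * (sy + IZR ky)
       + IZR (m1 * m2) * (sz + IZR kz) = IZR m * (sw + IZR kw))%R /\
    (IZR (m2 * m3) * (tx + IZR lx) + IZR (m1 * m4) * (ty + IZR ly)
       + IZR (m1 * m2) * (tz + IZR lz) = IZR m * (tw + IZR lw))%R).
  { apply (lattice_coords_eq A B _ _ _ _ hA hBA).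
    transitivity (ZtoC m * w)%C.
    - rewrite <- Hrel, Ex, Ey, Ez. unfold ZtoC.
      repeat rewrite ?RtoC_plus, ?RtoC_mult. ring.
    - rewrite Ew. unfold ZtoC. repeat rewrite ?RtoC_plus, ?RtoC_mult. ring. }
  destruct Hcoord as [HcA HcB].
  assert (HjA : jx = jw).
  { destruct (hsol jx jy jz jw Jx Jy Jz Jw) as (? & ? & ?); [| congruence].
    apply (digits_of_integral_relation (m2 * m3) (m1 * m4) (m1 * m2) m L
      (* This integer collects the lattice offsets of the four points along [A], moved to the
         right-hand side of [HcA]. *)
      (m * kw - m2 * m3 * kx - m1 * m4 * ky - m1 * m2 * kz) jx jy jz jw
      sx sy sz sw); auto.
    rewrite !minus_IZR, (mult_IZR m kw), (mult_IZR (m2 * m3) kx),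
      (mult_IZR (m1 * m4) ky), (mult_IZR (m1 * m2) kz). lra. }
  assert (HjB : ix = iw).
  { destruct (hsol ix iy iz iw Ix Iy Iz Iw) as (? & ? & ?); [| congruence].
    apply (digits_of_integral_relation (m2 * m3) (m1 * m4) (m1 * m2) m L
      (m * lw - m2 * m3 * lx - m1 * m4 * ly - m1 * m2 * lz) ix iy iz iw
      tx ty tz tw); auto.
    rewrite !minus_IZR, (mult_IZR m lw), (mult_IZR (m2 * m3) lx),
      (mult_IZR (m1 * m4) ly), (mult_IZR (m1 * m2) lz). lra. }
  subst jx ix.
  (* Now [x] and [w] share both digits, so each coordinate of [x - w] is a difference of two points
     of one short interval plus an integer; that integer is the one used below to bound
     [dist_int]. *)
  assert (Hco : coords A B (x - w)%C
    = ((sx - sw + IZR (kx - kw))%R, (tx - tw + IZR (lx - lw))%R)).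
  { apply (coords_exists_unique A B (x - w)%C hA hBA).
    rewrite Ex, Ew, !minus_IZR.
    repeat rewrite ?RtoC_plus, ?RtoC_minus. ring. }
  unfold norm_AB. rewrite Hco. simpl fst. simpl snd.
  apply Rmax_lub_lt.
  - apply dist_int_lt with (kx - kw)%Z.
    replace (sx - sw + IZR (kx - kw) - IZR (kx - kw))%R with (sx - sw)%R by ring.
    now apply in_interval_same_digit with jw.
  - apply dist_int_lt with (lx - lw)%Z.
    replace (tx - tw + IZR (lx - lw) - IZR (lx - lw))%R with (tx - tw)%R by ring.
    now apply in_interval_same_digit with iw.
Qed.
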